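(* Let $d \ge 2$ be an integer, let $n = d-1$, and let $f,g : \mathbb{F}_2^d \to \mathbb{F}_2$ be two linear bipermutive local rules of diameter $d$, with associated no-boundary cellular automata $F,G : \mathbb{F}_2^{2n} \to \mathbb{F}_2^n$. Assume that $F$ and $G$ are orthogonal cellular automata, i.e. the two Latin squares of order $2^n$ generated by $F$ and $G$ are orthogonal. Let $H : \mathbb{F}_2^{2n} \to \mathbb{F}_2^{2n}$ be the map $H(s) = (F(s), G(s))$. Then the period $p$ under $H$ of any state $s \in \mathbb{F}_2^{2n}$ satisfies $p \le 2^{2n}-1$.
   Context: A linear bipermutive local rule of diameter $d$ over $\mathbb{F}_2$ is a map $f(x_1,\dots,x_d) = a_1x_1 + \cdots + a_dx_d$ with $a_i \in \mathbb{F}_2$ and $a_1 = a_d = 1$. The no-boundary cellular automaton (NBCA) on $2n = 2(d-1)$ cells with local rule $f$ is the map $F : \mathbb{F}_2^{2n} \to \mathbb{F}_2^{n}$ given by $$F(x_1,\dots,x_{2n}) = (f(x_1,\dots,x_d), f(x_2,\dots,x_{d+1}), \dots, f(x_{n},\dots,x_{2n})).$$ Similarly $G$ is the NBCA with local rule $g$. Identify $\mathbb{F}_2^{2n}$ with $\mathbb{F}_2^n \times \mathbb{F}_2^n$ by splitting a vector into its left half $x$ and its right half $y$. The square generated by $F$ is the $2^n \times 2^n$ array, with rows and columns indexed by $\mathbb{F}_2^n$ and entries in $\mathbb{F}_2^n$, whose entry in row $x$ and column $y$ is $F(x,y)$; for a bipermutive local rule it is known to be a Latin square (each row and each column is a permutation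 of $\mathbb{F}_2^n$). Two Latin squares $L_1, L_2$ are orthogonal if $(L_1(x,y), L_2(x,y)) \ne (L_1(x',y'), L_2(x',y'))$ for all distinct pairs of coordinates $(x,y) \neq (x',y')$. The period of a state $s \in \mathbb{F}_2^{2n}$ under $H$ is the smallest positive integer $p$ such that $H^p(s) = s$, where $H^p$ denotes the $p$-fold iterate of $H$. *)

(* Defs.v *)
From mathcomp Require Import all_boot all_order all_algebra.

Set Implicit Arguments.
Unset Strict Implicit.
Unset Printing Implicit Defensive.

Import GRing.Theory.
Local Open Scope ring_scope.

(* Vectors are indexed from 0, so a_1 and a_d are the coefficients at the     *)
(* indices 0 and d.-1. They are quantified over as ordinals of 'I_d because   *)
(* 'I_d has a canonical first and last element only when d is a successor.    *)
Definition linear_bipermutive (d : nat) (f : 'rV['F_2]_d -> 'F_2) : Prop :=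
  exists a : 'rV['F_2]_d,
    [/\ forall i : 'I_d, val i = 0%N -> a 0 i = 1,
        forall i : 'I_d, val i = d.-1 -> a 0 i = 1
      & forall x : 'rV['F_2]_d, f x = \sum_(i < d) a 0 i * x 0 i].

Fact nbca_cell_subproof (d : nat) (i : 'I_d.-1) (j : 'I_d) :
  (i + j < d.-1 + d.-1)%N.
Proof.
case: d i j => [|d] i j /=; first by case: j.
by rewrite -addSn leq_add // -ltnS.
Qed.

Definition nbca_cell (d : nat) (i : 'I_d.-1) (j : 'I_d) : 'I_(d.-1 + d.-1) :=
  Ordinal (nbca_cell_subproof i j).

Definition nbca (d : nat) (f : 'rV['F_2]_d -> 'F_2)
    (s : 'rV['F_2]_(d.-1 + d.-1)) : 'rV['F_2]_d.-1 :=
  \row_(i < d.-1) f (\row_(j < d) s 0 (nbca_cell i j)).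

Definition square_of (n : nat) (F : 'rV['F_2]_(n + n) -> 'rV['F_2]_n)
    (x y : 'rV['F_2]_n) : 'rV['F_2]_n :=
  F (row_mx x y).

Definition orthogonal_squares (T : Type) (L1 L2 : T -> T -> T) : Prop :=
  forall x y x' y' : T,
    (x, y) <> (x', y') -> (L1 x y, L2 x y) <> (L1 x' y', L2 x' y').

(* The Latin property is not repeated here: the square of an NBCA with a      *)
(* bipermutive local rule is always Latin.                                    *)
Definition orthogonal_ca (n : nat)
    (F G : 'rV['F_2]_(n + n) -> 'rV['F_2]_n) : Prop :=
  orthogonal_squares (square_of F) (square_of G).

Definition joint_map (n : nat) (F G : 'rV['F_2]_(n + n) -> 'rV['F_2]_n)
    (s : 'rV['F_2]_(n + n)) : 'rV['F_2]_(n + n) :=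
  row_mx (F s) (G s).

Definition is_period (T : Type) (H : T -> T) (s : T) (p : nat) : Prop :=
  [/\ (0 < p)%N, iter p H s = s
    & forall q : nat, (0 < q)%N -> iter q H s = s -> (p <= q)%N].

(* Main.v *)
Require Import Defs.
From mathcomp Require Import all_boot all_order all_algebra.

(** Orthogonality says that [H] is injective, hence a permutation of a finite
    set, and linearity says that [H] fixes [0]. The orbit of a nonzero state
    therefore misses [0], while the period of [0] is [1 <= 2 ^ (2 * n) - 1]. *)

Import GRing.Theory.
Local Open Scope ring_scope.

Lemma nbca0 (d : nat) (f : 'rV['F_2]_d -> 'F_2) :
  linear_bipermutive f -> nbca f 0 = 0.
Proof.
move=> [a [_ _ fE]]; apply/rowP => i; rewrite !mxE fE big1 // => j _.
by rewrite !mxE mulr0.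
Qed.

Lemma joint_map_inj (n : nat) (F G : 'rV['F_2]_(n + n) -> 'rV['F_2]_n) :
  orthogonal_ca F G -> injective (joint_map F G).
Proof.
move=> orthFG s t /eq_row_mx[eqF eqG]; apply/eqP/negPn/negP => /eqP neq_st.
(* The halves of [s] and [t] index two distinct cells with the same pair of entries. *)
apply: (orthFG (lsubmx s) (rsubmx s) (lsubmx t) (rsubmx t)).
  by case=> eql eqr; apply: neq_st; rewrite -[s]hsubmxK -[t]hsubmxK eql eqr.
by rewrite /square_of !hsubmxK eqF eqG.
Qed.

(** An injective [H] returns to [s] after [order H s] steps, so a least positive return time
    exists. *)
Lemma is_period_ex (T : finType) (H : T -> T) (s : T) :
  injective H -> exists p : nat, is_period H s p.
Proof.
move=> injH.
have exq : exists q, (0 < q)%N && (iter q H s == s).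
  by exists (order H s); rewrite order_gt0 iter_order ?eqxx.
case: (ex_minnP exq) => p /andP[p_gt0 /eqP Hp] min_p.
exists p; split=> // q q_gt0 Hq.
by apply: min_p; rewrite q_gt0 Hq eqxx.
Qed.

(** If the orbit of [s] reached [z = H z], cancelling [H] step by step would give [s = z]. The
    orbit, of size [order H s], thus lies in the complement of [z]. *)
Lemma order_fixpoint_bound (T : finType) (H : T -> T) (s z : T) :
  injective H -> H z = z -> s != z -> (order H s <= #|T|.-1)%N.
Proof.
move=> injH Hz neq_sz; rewrite -(cardC1 z); apply/subset_leq_card/subsetP => t.
move=> /iter_findex <-; apply: contraNN neq_sz.
by elim: (findex H s t) => //= k IHk; rewrite -{1}Hz inj_eq.
Qed.

Theorem theorem2 (d : nat) (hd : (2 <= d)%N)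
    (f g : 'rV['F_2]_d -> 'F_2)
    (hf : linear_bipermutive f) (hg : linear_bipermutive g)
    (hFG : orthogonal_ca (nbca f) (nbca g))
    (s : 'rV['F_2]_(d.-1 + d.-1)) :
  let H := joint_map (nbca f) (nbca g) in
  (exists p : nat, is_period H s p) /\
  (forall p : nat, is_period H s p -> (p <= 2 ^ (2 * d.-1) - 1)%N).
Proof.
move=> H; have injH : injective H := joint_map_inj _ _ _ hFG.
have H0 : H 0 = 0 by rewrite /H /joint_map !nbca0 // row_mx0.
split=> [|p [_ _ min_p]]; first exact: is_period_ex.
have [s0|s_neq0] := eqVneq s 0.
  apply: leq_trans (min_p 1%N _ _) _; rewrite ?s0 //.
  (* Here [hd] matters: for [d = 1] the bound would be [0]. *)
  by rewrite subn_gt0 -{1}(expn0 2) ltn_exp2l // muln_gt0 /= -subn1 subn_gt0.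
apply: leq_trans (min_p _ (order_gt0 H s) (iter_order injH s)) _.
apply: leq_trans (order_fixpoint_bound _ _ _ _ injH H0 s_neq0) _.
by rewrite card_mx card_Fp // mul1n addnn -mul2n subn1.
Qed.
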